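(* Let $k\ge 2$ be a constant. Let $G=(V,E)$ be an arbitrary graph on $n$ vertices, and suppose that the edge weights $(X_e)_{e\in E}$ are independent random variables, where $X_e$ has a probability density function $f_e:[-1,1]\rightarrow [0,\phi]$ for some $\phi>0$. Then for every constant $\eta>0$, with probability $1-o(1)$ as $n\to\infty$, every implementation of the FLIP method for Max-$k$-Cut terminates in at most $O(\phi n^{2(2k-1)k \log{(kn)}+3+\eta})$ steps.
   Context: A $k$-cut of $G$ is a partition of $V$ into $k$ parts; its value is the total weight of edges of $G$ whose endpoints lie in different parts. The FLIP method for Max-$k$-Cut starts from an arbitrary $k$-cut and, as long as possible, moves a single vertex from its current part to one of the other $k-1$ parts provided this strictly increases the cut value; it stops when no such move exists. An implementation specifies the initial $k$-cut, which vertex is moved at each step, and to which part; ''every implementation'' means the bound holds simultaneously for all such choices. Random noise is added only to the edges of $G$. *)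

(* Defs.v *)
From HB Require Import structures.
From mathcomp Require Import all_boot all_order all_algebra.
From mathcomp Require Import all_classical all_reals all_analysis.

Set Implicit Arguments.
Unset Strict Implicit.
Unset Printing Implicit Defensive.
Import Order.TTheory GRing.Theory Num.Theory.
Import numFieldNormedType.Exports.
Local Open Scope classical_set_scope.
Local Open Scope ring_scope.

(* A finite simple graph on V is given by its set of edges, each edge being
   the set of its two endpoints. *)
Definition simple_graph (V : finType) (E : {set {set V}}) : Prop :=
  forall e, e \in E -> #|e| = 2%N.

(* The parts are labelled by 'I_k and are allowed to be empty. *)
Definition kcut (V : finType) (k : nat) := {ffun V -> 'I_k}.

Section Flip.
Context {R : realType} {V : finType} {k : nat}.
Implicit Types (E : {set {set V}}) (wt : {set V} -> R) (c : kcut V k).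

Definition crosses c (e : {set V}) : bool :=
  [exists u in e, exists v in e, c u != c v].

Definition cut_value E wt c : R := \sum_(e in E | crosses c e) wt e.

Definition move_vertex c (v : V) (p : 'I_k) : kcut V k :=
  [ffun u => if u == v then p else c u].

Definition improving E wt c (v : V) (p : 'I_k) : bool :=
  (p != c v) && (cut_value E wt c < cut_value E wt (move_vertex c v p)).

Definition locally_optimal E wt c : bool :=
  ~~ [exists v, exists p, improving E wt c v p].

(* The sequences of choices are not adaptive, but implementations are
   quantified over after the weights are fixed, so that the choices of an
   adaptive or randomized rule on these weights are such sequences as well.
   The choices made for steps that come after termination are ignored. *)
Record implementation := Implementation {
  initial_cut : kcut V k;
  chosen_vertex : nat -> V;
  chosen_part : nat -> 'I_k }.

Fixpoint cut_after E wt (I : implementation) (t : nat) : kcut V k :=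
  if t is s.+1 then
    let c := cut_after E wt I s in
    if locally_optimal E wt c then c
    else move_vertex c (chosen_vertex I s) (chosen_part I s)
  else initial_cut I.

Definition implements_flip E wt (I : implementation) : Prop :=
  forall t, ~~ locally_optimal E wt (cut_after E wt I t) ->
    improving E wt (cut_after E wt I t) (chosen_vertex I t) (chosen_part I t).

Definition terminates_within E wt (I : implementation) (T : R) : Prop :=
  exists t : nat, t%:R <= T /\ locally_optimal E wt (cut_after E wt I t).

Definition every_flip_terminates_within E wt (T : R) : Prop :=
  forall I, implements_flip E wt I -> terminates_within E wt I T.

End Flip.

Arguments implementation : clear implicits.
Arguments every_flip_terminates_within {R V} k E wt T.

Section Weights.
Context {R : realType} {d : measure_display} {Omega : measurableType d}.
Variable P : probability Omega R.

(* Mutual independence of the finite family (X i), i in A. *)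
Definition mutually_independent (I : finType) (A : {set I})
    (X : I -> {RV P >-> R}) : Prop :=
  forall (J : {set I}) (B : I -> set R), J \subset A ->
    (forall i, i \in J -> measurable (B i)) ->
    (P [set w | forall i, i \in J -> B i (X i w)] =
     \prod_(i in J) P (X i @^-1` B i))%E.

(* The values of f outside of [-1, 1] are irrelevant. *)
Definition has_density_bounded_by (X : {RV P >-> R}) (f : R -> R) (phi : R)
    : Prop :=
  [/\ measurable_fun (`[-1, 1] : set R) f,
      forall x, -1 <= x <= 1 -> 0 <= f x <= phi &
      forall B : set R, measurable B ->
        (P (X @^-1` B) =
         \int[lebesgue_measure]_(x in B `&` `[(-1)%R, 1%R]) (f x)%:E)%E].

End Weights.

Arguments mutually_independent {R d Omega} P {I} A X.
Arguments has_density_bounded_by {R d Omega} P X f phi.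

(* Main.v *)
(* Call a vertex busy in a block of consecutive moves if it moves at least k
   times there. Some part is then revisited by it, and the gains of its moves
   between the two visits add up to a linear form in the weights of edges at this
   vertex whose coefficients are integers that depend only on the vertices moving
   in the block: the contribution of a vertex that stays put telescopes to zero.
   All gains being positive, this form is not zero. Every two busy vertices yield
   one more "independent" form, so that for a fixed combinatorial type of the
   block all gains are at most eps with probability at most
   (2 phi l eps)^(|busy| / 2), where l is the length of the block. A dyadic
   counting argument finds, in each run of 2^m > 2 (k - 1) n moves, a block with
   |busy| > l / (2 (k - 1) m); there are at most (n k^2)^l combinatorial types, so
   a union bound applies with eps = n^(-O(log n)) / phi. Hence every 2^m moves raise the
   cut value by eps, while it stays between -n^2 / 2 and n^2 / 2. *)
Require Import Defs.
From HB Require Import structures.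
From mathcomp Require Import all_boot all_order all_algebra zify ring lra.
From mathcomp Require Import all_classical all_reals all_analysis measurable_realfun.
Import Order.TTheory GRing.Theory Num.Theory.
Import numFieldNormedType.Exports.

(** * Busy blocks *)

Section Blocks.
Set Implicit Arguments.
Unset Strict Implicit.
Variables (V : finType) (k : nat).
Implicit Types (mv : nat -> V) (v : V) (s l i m : nat).

Definition visits mv v s l : nat := \sum_(s <= t < s + l) (mv t == v).

Definition busy mv s l : {set V} := [set v | (k <= visits mv v s l)%N].

Lemma visits_cat mv v s l l' :
  visits mv v s (l + l') = (visits mv v s l + visits mv v (s + l) l')%N.
Proof. by rewrite /visits addnA -big_cat_nat ?leq_addr. Qed.

(** Visits of a vertex beyond the first [k - 1] do not count, which keeps the total at most
    [(k - 1) * #|V|] on every block, however long. *)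
Let capped mv s l := \sum_v minn (visits mv v s l) k.-1.

(** At a vertex with fewer than [k] visits to the joined block nothing is truncated. Any other
    vertex is busy there, and its two halves contribute at most [2 * (k - 1)]. *)
Lemma capped_split mv s l l' :
  (capped mv s l + capped mv (s + l) l' <=
   capped mv s (l + l') + k.-1 * #|busy mv s (l + l')|)%N.
Proof.
rewrite -sum1_card big_distrr /= -big_split /= [X in (_ <= _ + X)%N]big_mkcond.
rewrite -big_split /=; apply: leq_sum => v _.
rewrite inE visits_cat; case: ifP; lia.
Qed.

Lemma exists_busy_block mv m :
  (2 <= k)%N -> (2 * k.-1 * #|V| < 2 ^ m)%N ->
  exists s i, [/\ (i <= m)%N, (s + 2 ^ i <= 2 ^ m)%N &
    (2 ^ i < #|busy mv s (2 ^ i)| * (2 * k.-1 * m))%N].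
Proof.
move=> k2 Vm; apply/not_existsP => NB.
pose D := (2 * k.-1 * m)%N.
have {}NB s i : (i <= m)%N -> (s + 2 ^ i <= 2 ^ m)%N ->
    (#|busy mv s (2 ^ i)| * D <= 2 ^ i)%N.
  move=> im sm; rewrite leqNgt; apply/negP => lt.
  by apply: (NB s); exists i; split.
(* Under [NB], passing from length [2 ^ i] to [2 ^ i.+1] loses at most [(k - 1) * 2 ^ i.+1 / D]
   capped visits. After [m] doublings at least [2 ^ m / 2] remain, which is more than
   [(k - 1) * #|V|]. *)
suff H i : (i <= m)%N -> forall s, (s + 2 ^ i <= 2 ^ m)%N ->
    (2 ^ i * D <= D * capped mv s (2 ^ i) + k.-1 * i * 2 ^ i)%N.
  have := H m (leqnn _) 0 (leqnn _).
  have : (capped mv 0 (2 ^ m) <= k.-1 * #|V|)%N.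
    rewrite mulnC -sum_nat_const; apply: leq_sum => v _; exact: geq_minr.
  have m0 : (0 < m)%N.
    case: m Vm {NB H D} => //; rewrite expn0 ltnS leqn0 !muln_eq0 /=.
    have -> : (k.-1 == 0)%N = false by lia.
    move=> /eqP V0.
    have : (#|V| > 0)%N by apply/card_gt0P; exists (mv 0).
    by rewrite V0.
  rewrite /D; set c := capped _ _ _; set M := (2 ^ m)%N in Vm *; move: #|V| Vm => n Vm cn.
  have : (k.-1 * m * (2 * k.-1 * n) < k.-1 * m * M)%N.
    by rewrite ltn_pmul2l // muln_gt0 m0; lia.
  have : (2 * k.-1 * m * c <= 2 * k.-1 * m * (k.-1 * n))%N by rewrite leq_mul2l cn orbT.
  nia.
elim: i => [|i IH] im s sm.
  rewrite expn0 mul1n muln0 mul0n addn0 -{1}[D]muln1 leq_mul2l; apply/orP; right.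
  rewrite /capped (bigD1 (mv s)) //= /visits addn1 big_nat1 eqxx.
  by apply: leq_trans (leq_addr _ _); lia.
have e2 : (2 ^ i.+1 = 2 ^ i + 2 ^ i)%N by rewrite expnS mul2n addnn.
have H1 : (s + 2 ^ i <= 2 ^ m)%N by lia.
have H2 : (s + 2 ^ i + 2 ^ i <= 2 ^ m)%N by lia.
have := IH (ltnW im) _ H1; have := IH (ltnW im) _ H2.
have := NB _ _ im sm; have := capped_split mv s (2 ^ i) (2 ^ i).
rewrite -e2.
set a := capped _ _ _; set b := capped _ _ _; set c := capped _ _ _.
set u := #|_|; rewrite e2; move: (2 ^ i)%N => M h1 h2 h3 h4.
have : (D * (a + b) <= D * (c + k.-1 * u))%N by rewrite leq_mul2l h1 orbT.
have : (k.-1 * (u * D) <= k.-1 * (M + M))%N by rewrite leq_mul2l h2 orbT.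
nia.
Qed.

End Blocks.

Local Open Scope classical_set_scope.
Local Open Scope ring_scope.

(** * Rows of a block *)

Section Runs.
Set Implicit Arguments.
Unset Strict Implicit.
Variables (V : finType) (k : nat).
Implicit Types (c : kcut V k) (mv : nat -> V) (pt : nat -> 'I_k) (e : {set V}).

Fixpoint run c mv pt (t : nat) : kcut V k :=
  if t is s.+1 then move_vertex (run c mv pt s) (mv s) (pt s) else c.

Definition gain c mv pt (t : nat) e : int :=
  (crosses (run c mv pt t.+1) e)%:Z - (crosses (run c mv pt t) e)%:Z.

(** These are the coefficients of the total gain of the moves of [v], by [row_sum]. Integrality
    matters: a nonzero coefficient has absolute value at least 1. *)
Definition row c mv pt (v : V) (a b : nat) e : int :=
  \sum_(a <= t < b | mv t == v) gain c mv pt t e.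

Lemma crosses2 c (u v : V) : crosses c [set u; v] = (c u != c v).
Proof.
apply/existsP/idP => [[x /andP[]]|uv].
  rewrite !inE => /orP[]/eqP -> /existsP[y /andP[]]; rewrite !inE => /orP[]/eqP -> //;
    by rewrite ?eqxx // eq_sym.
by exists u; rewrite !inE eqxx /=; apply/existsP; exists v; rewrite !inE eqxx orbT.
Qed.

Lemma crosses_move c (v : V) p e : v \notin e ->
  crosses (move_vertex c v p) e = crosses c e.
Proof.
move=> ve; have mE z : z \in e -> move_vertex c v p z = c z.
  by rewrite ffunE; case: eqP => // -> ve'; rewrite ve' in ve.
rewrite /crosses; apply: eq_existsb => x; case: (boolP (x \in e)) => //= xe.
by apply: eq_existsb => y; case: (boolP (y \in e)) => //= ye; rewrite !mE.
Qed.

Lemma row_notin c mv pt v a b e : v \notin e -> row c mv pt v a b e = 0.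
Proof.
move=> ve; apply: big1 => t /eqP mvt.
by rewrite /gain /= crosses_move ?subrr // mvt.
Qed.

Lemma cut_value_gain (R : realType) (E : {set {set V}}) (wt : {set V} -> R) c mv pt t :
  cut_value E wt (run c mv pt t.+1) - cut_value E wt (run c mv pt t) =
  \sum_(e in E) (gain c mv pt t e)%:~R * wt e.
Proof.
rewrite /cut_value !big_mkcondr /= -sumrB; apply: eq_bigr => e _.
by rewrite /gain rmorphB /= mulrBl; do 2 case: crosses;
  rewrite ?mul1r ?mul0r.
Qed.

Lemma row_sum (R : realType) (E : {set {set V}}) (wt : {set V} -> R) c mv pt v a b :
  \sum_(e in E) (row c mv pt v a b e)%:~R * wt e =
  \sum_(a <= t < b | mv t == v)
    (cut_value E wt (run c mv pt t.+1) - cut_value E wt (run c mv pt t)).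
Proof.
under [RHS]eq_bigr do rewrite cut_value_gain.
rewrite exchange_big /=; apply: eq_bigr => e _.
by rewrite /row rmorph_sum /= mulr_suml.
Qed.

Lemma run_agree l c mv pt c' mv' pt' u :
  (forall t, (t < l)%N -> mv t = mv' t) -> (forall t, (t < l)%N -> pt t = pt' t) ->
  c u = c' u ->
  forall t, (t <= l)%N -> run c mv pt t u = run c' mv' pt' t u.
Proof.
move=> mvE ptE cu; elim=> [//|t IH tl].
by rewrite /= !ffunE mvE // ptE // IH // ltnW.
Qed.

Lemma run_still l c mv pt u : (forall t, (t < l)%N -> mv t != u) ->
  forall t, (t <= l)%N -> run c mv pt t u = c u.
Proof.
move=> st; elim=> [//|t IH tl].
by rewrite /= !ffunE [u == _]eq_sym (negPf (st _ tl)) IH // ltnW.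
Qed.

(* Against a vertex [u] that never moves, the gains of [v] telescope to zero
   when [v] returns to its initial part. *)
Lemma row_still l c mv pt v a b u :
  (forall t, (t < l)%N -> mv t != u) -> (a <= b <= l)%N ->
  run c mv pt a v = run c mv pt b v ->
  row c mv pt v a b [set v; u] = 0.
Proof.
move=> st /andP[ab bl] cl.
rewrite /row big_mkcond /=.
transitivity (\sum_(a <= t < b)
   ((run c mv pt t.+1 v != c u)%:Z - (run c mv pt t v != c u)%:Z)).
  apply: eq_big_nat => t /andP[_ tb]; have tl := leq_trans tb bl.
  rewrite /gain !crosses2 (run_still _ _ st tl) (run_still _ _ st (ltnW tl)).
  by case: eqVneq => // nv; rewrite /= ffunE [v == _]eq_sym (negPf nv) subrr.
by rewrite telescope_sumr // cl subrr.
Qed.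

(** If the other end of an edge at [v] moves, both runs treat it alike; if it stays put, both
    coefficients vanish by [row_still]. Hence a code of a block may omit the parts of all resting
    vertices. *)
Lemma row_agree l c mv pt c' mv' pt' v a b e :
  (forall t, (t < l)%N -> mv t = mv' t) -> (forall t, (t < l)%N -> pt t = pt' t) ->
  (forall t, (t < l)%N -> c (mv t) = c' (mv t)) ->
  #|e| = 2%N -> (a < b <= l)%N -> mv a = v ->
  run c mv pt a v = run c mv pt b v ->
  row c mv pt v a b e = row c' mv' pt' v a b e.
Proof.
move=> mvE ptE cE e2 /andP[ab bl] mva cl.
have [ve|ve] := boolP (v \in e); last by rewrite !row_notin.
have cv : c v = c' v by rewrite -mva cE // (leq_trans ab).
have [u uv ->] : exists2 u, u != v & e = [set v; u]%SET.
  have /cards2P[x [y [xy eE]]] : #|e| == 2%N by apply/eqP.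
  move: ve; rewrite eE !inE => /orP[]/eqP ->; first by exists y; rewrite // eq_sym.
  by exists x; rewrite // finset.setUC.
have [/existsP[[t /= tl] /eqP mvt]|] := boolP [exists t : 'I_l, mv t == u].
  have cu : c u = c' u by rewrite -mvt cE.
  rewrite /row big_nat_cond [RHS]big_nat_cond; apply: eq_big => s.
    by apply: andb_id2l => /andP[_ sb]; rewrite mvE // (leq_trans sb).
  move=> /andP[/andP[_ sb] _]; rewrite /gain !crosses2; have sl := leq_trans sb bl.
  by rewrite !(run_agree mvE ptE cu) ?(run_agree mvE ptE cv) // ltnW.
move=> /existsPn st.
have st1 t : (t < l)%N -> mv t != u by move=> tl; exact: (st (Ordinal tl)).
have st2 t : (t < l)%N -> mv' t != u by move=> tl; rewrite -mvE // st1.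
rewrite !(@row_still l) ?(ltnW ab) //.
by rewrite -!(run_agree mvE ptE cv) // (leq_trans (ltnW ab)).
Qed.

(** Pigeonhole: the times just before the moves of [v], together with the end time [l], are at least
    [k + 1] times for [k] parts. The earlier of two coinciding times is not [l], so [v] moves
    then. *)
Lemma busy_returns c mv pt l v : v \in busy k mv 0 l ->
  exists a b, [/\ (a < b <= l)%N, mv a = v & run c mv pt a v = run c mv pt b v].
Proof.
rewrite inE /visits add0n big_mkord => kv.
pose S := [set t : 'I_l.+1 | (t == l :> nat) || (mv t == v)]%SET.
have cS : (k < #|S|)%N.
  have -> : S = (ord_max |: [set widen_ord (leqnSn l) t | t : 'I_l & mv t == v])%SET.
    apply/setP => t; rewrite !inE -val_eqE /=; case: eqVneq => //= tl.
    have tl' : (t < l)%N by move: (ltn_ord t) tl; lia.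
    apply/idP/imsetP => [tv|[s]]; first by exists (Ordinal tl'); [rewrite inE|exact: ord_inj].
    by rewrite inE => sv ->.
  rewrite cardsU1 card_imset; last by move=> x y /(congr1 val) /= xy; exact: ord_inj.
  rewrite (_ : _ \notin _ = true); last first.
    apply/negP => /imsetP[s _ /(congr1 val)] /= ls.
    by move: (ltn_ord s); rewrite -ls ltnn.
  rewrite add1n ltnS (leq_trans kv) // -sum1_card big_mkcond /= [leqRHS]big_mkcond /=.
  by apply: leq_sum => t _; rewrite inE; case: eqP.
have /dinjectivePn[x xS [y /andP[/= yx yS] xy]] : ~~ dinjectiveb (fun t : 'I_l.+1 => run c mv pt t v) S.
  apply/negP => /dinjectiveP inj; move: cS; rewrite -(card_in_imset inj).
  by rewrite ltnNge -[X in (_ <= X)%N](card_ord k) max_card.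
wlog lt : x y xS yx yS xy / (x < y)%N.
  move=> H; case: (ltngtP x y) => [||/ord_inj]; first exact: H.
    by apply: (H y x) => //; rewrite eq_sym.
  by move=> e; rewrite e eqxx in yx.
exists x, y; split => //; first by rewrite lt -ltnS ltn_ord.
by move: xS; rewrite inE => /orP[/eqP xl|/eqP//]; move: (ltn_ord y); lia.
Qed.

(* A block of [l] moves is encoded by listing, for each move, the moving vertex,
   the part it moves to, and the part in which that vertex starts. *)
Lemma block_rows (R : realType) (E : {set {set V}}) (l : nat) :
  simple_graph E ->
  exists (S : l.-tuple (V * 'I_k * 'I_k) -> {set V})
    (A : l.-tuple (V * 'I_k * 'I_k) -> V -> {set V} -> int),
  (forall x v e, v \notin e -> A x v e = 0) /\
  forall c mv pt, exists2 x, S x = busy k mv 0 l &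
    forall (wt : {set V} -> R) (eps : R) v, v \in S x ->
      (forall t, (t < l)%N -> 0 < cut_value E wt (run c mv pt t.+1) -
                                 cut_value E wt (run c mv pt t) <= eps) ->
      0 < \sum_(e in E) (A x v e)%:~R * wt e <= l%:R * eps.
Proof.
move=> Esimple.
(* With no vertex or no part there are no moves to encode; otherwise [v0] and [p0] serve as default
   values for [nth]. *)
have [/existsP[v0 _]|/existsPn V0] := boolP [exists v : V, true]; last first.
  exists (fun=> finset.set0), (fun _ _ _ => 0); split => // c mv.
  by have := V0 (mv 0).
have [/existsP[p0 _]|/existsPn k0] := boolP [exists p : 'I_k, true]; last first.
  exists (fun=> finset.set0), (fun _ _ _ => 0); split => // c mv pt.
  by have := k0 (pt 0).
pose x0 := (v0, p0, p0).
pose cmv (x : l.-tuple (V * 'I_k * 'I_k)) t := (nth x0 x t).1.1.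
pose cpt (x : l.-tuple (V * 'I_k * 'I_k)) t := (nth x0 x t).1.2.
(* The starting part of [u] is read off at its first occurrence among the movers. A vertex that
   never moves gets the default [p0], harmless by [row_agree]. *)
pose cc (x : l.-tuple (V * 'I_k * 'I_k)) : kcut V k :=
  [ffun u => (nth x0 x (seq.index u [seq y.1.1 | y <- x])).2].
(* The return times are chosen from the code alone, so that the rows do not depend on the actual
   starting cut. *)
have /choice[f fP] (xv : l.-tuple (V * 'I_k * 'I_k) * V) : exists ab : nat * nat,
    xv.2 \in busy k (cmv xv.1) 0 l ->
    [/\ (ab.1 < ab.2 <= l)%N, cmv xv.1 ab.1 = xv.2 &
     run (cc xv.1) (cmv xv.1) (cpt xv.1) ab.1 xv.2 =
     run (cc xv.1) (cmv xv.1) (cpt xv.1) ab.2 xv.2].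
  have [vb|_] := boolP (xv.2 \in busy k (cmv xv.1) 0 l); last by exists (0, 0)%N.
  by have [a [b H]] := busy_returns (cc xv.1) (cpt xv.1) vb; exists (a, b).
exists (fun x => busy k (cmv x) 0 l).
exists (fun x v => row (cc x) (cmv x) (cpt x) v (f (x, v)).1 (f (x, v)).2).
split=> [x v e|c mv pt]; first exact: row_notin.
pose x := [tuple (mv i, pt i, c (mv i)) | i < l].
have xE t (tl : (t < l)%N) : nth x0 x t = (mv t, pt t, c (mv t)).
  by rewrite -[t]/(nat_of_ord (Ordinal tl)) -tnth_nth tnth_mktuple.
have mvE t : (t < l)%N -> cmv x t = mv t by move=> tl; rewrite /cmv xE.
have ptE t : (t < l)%N -> cpt x t = pt t by move=> tl; rewrite /cpt xE.
have ccE t : (t < l)%N -> cc x (cmv x t) = c (cmv x t).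
  move=> tl; rewrite ffunE; set i := seq.index _ _.
  have mem : cmv x t \in [seq y.1.1 | y <- x].
    by rewrite /cmv; apply: map_f; rewrite mem_nth ?size_tuple.
  have il : (i < l)%N by move: mem; rewrite -index_mem size_map size_tuple.
  rewrite xE //=; congr (c _).
  by have := nth_index v0 mem; rewrite (nth_map x0) ?size_tuple // -/i xE.
exists x.
  apply/setP => v; rewrite !inE /visits add0n !big_mkord; congr (_ <= _)%N.
  by apply: eq_bigr => t _; rewrite mvE.
move=> wt eps v vb H.
have := fP (x, v) vb; case: (f _) => a b /= [/andP[ab bl] mva cl].
have rowE e : e \in E -> row (cc x) (cmv x) (cpt x) v a b e = row c mv pt v a b e.
  by move=> /Esimple e2; apply: (row_agree mvE ptE ccE) => //; rewrite ab.
rewrite (eq_bigr (fun e => (row c mv pt v a b e)%:~R * wt e)); last first.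
  by move=> e eE; rewrite rowE.
have a_lt_l := leq_trans ab bl.
rewrite row_sum; apply/andP; split.
  rewrite big_ltn_cond // -mvE // mva eqxx ltr_pwDl //.
    by have /andP[] := H a a_lt_l.
  rewrite big_nat_cond; apply: sumr_ge0 => t /andP[/andP[_ tb] _].
  by have /andP[/ltW] := H t (leq_trans tb bl).
have eps0 : 0 <= eps by have /andP[/ltW h1 h2] := H a a_lt_l; apply: le_trans h2.
rewrite big_mkcond /=; apply: (@le_trans _ _ (\sum_(a <= t < b) eps)).
  rewrite big_nat_cond [leRHS]big_nat_cond; apply: ler_sum => t /andP[/andP[_ tb] _].
  by case: ifP => // _; have /andP[_] := H t (leq_trans tb bl).
rewrite sumr_const_nat -[leLHS]mulr_natl ler_wpM2r // ler_nat.
by rewrite (leq_trans (leq_subr _ _)).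
Qed.

End Runs.

(** * Independence and anticoncentration *)

Section Independence.
Set Implicit Arguments.
Unset Strict Implicit.
Context {R : realType} {d : measure_display} {Omega : measurableType d}.
Variables (P : probability Omega R) (I : finType) (X : I -> {RV P >-> R}).

(** A pi-system generating the sigma-algebra of the variables with index in [J]. *)
Definition boxes (J : {set I}) : set (set Omega) :=
  [set F | exists2 B : I -> set R, (forall i, measurable (B i)) &
    F = [set w | forall i, i \in J -> B i (X i w)]].

Lemma measurable_box (J : {set I}) F : boxes J F -> measurable F.
Proof.
move=> [B mB ->].
rewrite (_ : [set w | _] = \bigcap_(i in [set` J]) (X i @^-1` B i)) //.
apply: fin_bigcap_measurable => // i _.
by rewrite -[X in measurable X]setTI; exact: measurable_funP.
Qed.

Lemma sigma_boxes_measurable (J : {set I}) F : <<s boxes J >> F -> measurable F.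
Proof.
apply: smallest_sub; first exact: sigma_algebra_measurable.
exact: measurable_box.
Qed.

Lemma boxes_setI (J : {set I}) : setI_closed (boxes J).
Proof.
move=> _ _ [B mB ->] [C mC ->]; exists (fun i => B i `&` C i).
  by move=> i; exact: measurableI.
apply/seteqP; split => [w [h1 h2] i iJ|w h]; first by split; [exact: h1|exact: h2].
by split => i /h[].
Qed.

(** Dynkin's pi-lambda argument: the events independent of [X i0 @^-1] C[form a lambda-system. It
    contains the boxes, since intersecting one with]X i0 @^-1[C] gives a box over [i0 |: J]. *)
Lemma independent_of_boxes (A J : {set I}) i0 F (C : set R) :
  mutually_independent P A X -> i0 \in A -> i0 \notin J -> J \subset A ->
  measurable C -> <<s boxes J >> F ->
  P (F `&` X i0 @^-1` C) = (P F * P (X i0 @^-1` C))%E.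
Proof.
move=> indep i0A i0J JA mC.
pose T' := g_sigma_algebraType (boxes J).
have mC' : measurable (X i0 @^-1` C).
  by rewrite -[X in measurable X]setTI; exact: measurable_funP.
have fC : P (X i0 @^-1` C) \is a fin_num by exact: fin_num_measure.
pose ind (S : set Omega) := P (S `&` X i0 @^-1` C) = (P S * P (X i0 @^-1` C))%E.
have ind_setC S : <<s boxes J >> S -> ind S -> ind (~` S).
  move=> /sigma_boxes_measurable mS PS.
  rewrite /ind setIC -setDE measureD //; last by rewrite ltey_eq fC.
  by rewrite setIC [X in (_ - X)%E]PS probability_setC // muleBl ?mul1e //.
have ind_bigcup (S : (set Omega)^nat) : (forall n, <<s boxes J >> (S n)) ->
    trivIset setT S -> (forall n, ind (S n)) -> ind (\bigcup_n S n).
  move=> sS tS PS; have mS n := sigma_boxes_measurable (sS n).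
  rewrite /ind setI_bigcupl !measure_bigcup //; first last.
  - exact: trivIset_setIr.
  - by move=> i _; exact: measurableI.
  rewrite (eq_eseriesr (g := fun i => (P (X i0 @^-1` C) * P (S i))%E)); last first.
    by move=> i _; rewrite muleC; exact: PS.
  by rewrite -(fineK fC) nneseriesZl 1?muleC.
apply: (@dynkin_induction _ T' (boxes J) ind) => //.
- exact: boxes_setI.
- by rewrite /ind setTI probability_setT mul1e.
- move=> _ [B mB ->]; rewrite /ind.
  have -> : [set w | forall i, i \in J -> B i (X i w)] `&` X i0 @^-1` C =
      [set w | forall i, i \in (i0 |: J)%SET ->
        (if i == i0 then C else B i) (X i w)].
    apply/seteqP; split => [w [h1 h2] i|w h].
      by rewrite !inE; case: eqP => [->|_] //= iJ; exact: h1.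
    split; last by have := h i0; rewrite !inE eqxx; exact.
    move=> i iJ; have := h i; rewrite !inE iJ orbT; case: eqP => [ii0|_]; last exact.
    by rewrite -ii0 iJ in i0J.
  rewrite (indep J B) // (indep _ (fun i => if i == i0 then C else B i)); first last.
  + by move=> i _; case: ifP.
  + by rewrite finset.subUset finset.sub1set i0A.
  rewrite big_setU1 //= eqxx muleC; congr (_ * _)%E.
  apply: eq_bigr => i iJ; case: eqP => // ii0.
  by rewrite -ii0 iJ in i0J.
Qed.

Lemma measurable_boxes (J : {set I}) i : i \in J ->
  measurable_fun [set: g_sigma_algebraType (boxes J)]
    (X i : g_sigma_algebraType (boxes J) -> R).
Proof.
move=> iJ _ C mC; rewrite setTI; apply: sub_sigma_algebra.
exists (fun j => if j == i then C else setT); first by move=> j; case: ifP.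
apply/seteqP; split => [w /= h j _|w /= /(_ i iJ)]; last by rewrite eqxx.
by case: eqP => [->|].
Qed.

(* Cutting the range of [Z] into cells of length [delta] replaces [Z] by a
   constant at the price of doubling the length of the window, so no joint law
   and no Fubini argument is needed. *)
Lemma anticoncentration (A J : {set I}) i0 F (Z : Omega -> R) (a : int)
    (delta q : R) :
  mutually_independent P A X -> i0 \in A -> i0 \notin J -> J \subset A ->
  0 < delta -> 0 <= q ->
  (forall c : R, (P (X i0 @^-1` `[(c - delta)%R, (c + delta)%R]) <= q%:E)%E) ->
  <<s boxes J >> F ->
  measurable_fun [set: g_sigma_algebraType (boxes J)]
    (Z : g_sigma_algebraType (boxes J) -> R) ->
  a != 0 ->
  measurable [set w | 0 < a%:~R * X i0 w + Z w <= delta] ->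
  (P (F `&` [set w | (0 < a%:~R * X i0 w + Z w <= delta)%R]) <= q%:E * P F)%E.
Proof.
move=> indep i0A i0J JA d0 q0 conc sF mZ a0 mE.
(* The integer cells are indexed by [nat] through [pickle_inv], to fit countable additivity; indices
   that code no integer get the empty cell. *)
pose cell (j : nat) : set R :=
  if pickle_inv j is Some m then `[(m : int)%:~R * delta, (m + 1)%:~R * delta[%classic
  else set0.
have mcell j : measurable (cell j) by rewrite /cell; case: pickle_inv.
pose T j := F `&` Z @^-1` (cell j).
have sT j : <<s boxes J >> (T j).
  apply: (@measurableI _ (g_sigma_algebraType (boxes J))) => //.
  by rewrite -[X in measurable X]setTI; exact: mZ.
have mT j : measurable (T j) by exact: sigma_boxes_measurable (sT j).
(* For [Z] in the cell of [m], the event puts [a * X i0 + m * delta] between [-delta] and [delta].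
   Dividing by the integer [a], of absolute value at least 1, puts [X i0] within [delta] of
   [- m * delta / a]. *)
pose win (j : nat) : set R :=
  if pickle_inv j is Some m then
    `[- ((m : int)%:~R * delta / a%:~R) - delta, - (m%:~R * delta / a%:~R) + delta]%classic
  else set0.
have mwin j : measurable (win j) by rewrite /win; case: pickle_inv.
have mXwin j : measurable (X i0 @^-1` win j).
  by rewrite -[X in measurable X]setTI; exact: measurable_funP.
have Pwin j : (P (X i0 @^-1` win j) <= q%:E)%E.
  rewrite /win; case: pickle_inv => [m|]; first exact: conc.
  by rewrite preimage_set0 measure0 lee_fin.
have tT : trivIset setT T.
  apply/trivIsetP => i j _ _ ij; apply/seteqP; split => // w [[_ wi] [_ wj]].
  move: ij wi wj; rewrite /cell /=.
  have := @pickle_invK int i; have := @pickle_invK int j.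
  case: pickle_inv => //= m mj; case: pickle_inv => //= n nj.
  rewrite -mj -nj /= !in_itv /= => mn /andP[h1 h2] /andP[h3 h4].
  have h5 : n%:~R * delta < (m + 1)%:~R * delta by exact: le_lt_trans h1 h4.
  have h6 : m%:~R * delta < (n + 1)%:~R * delta by exact: le_lt_trans h3 h2.
  move: h5 h6; rewrite !ltr_pM2r // !ltr_int => h5 h6.
  have mnE : m = n by lia.
  by rewrite mnE eqxx in mn.
have mF := sigma_boxes_measurable sF.
have sub : F `&` [set w | 0 < a%:~R * X i0 w + Z w <= delta] `<=`
    \bigcup_j (T j `&` X i0 @^-1` win j).
  move=> w [Fw /= /andP[w1 w2]].
  pose m := Num.floor (Z w / delta).
  have mE1 : m%:~R * delta <= Z w by rewrite -ler_pdivlMr // floor_le_tmp.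
  have mE2 : Z w < (m + 1)%:~R * delta by rewrite -ltr_pdivrMr // floorD1_gt.
  have [j jm] : exists j, pickle_inv j = Some m.
    by exists (pickle m); exact: pickleK_inv.
  have wcell : cell j (Z w) by rewrite /cell jm /= in_itv /= mE1.
  suff wwin : win j (X i0 w) by exists j.
  rewrite /win jm /= in_itv /=.
  have a1 : 1 <= `|a%:~R : R| by rewrite -intr_norm (ler_int _ 1) -gtz0_ge1 normr_gt0.
  have an0 : a%:~R != 0 :> R by rewrite intr_eq0.
  rewrite -ler_distl opprK.
  have -> : X i0 w + m%:~R * delta / a%:~R = (a%:~R * X i0 w + m%:~R * delta) / a%:~R.
    by field.
  rewrite normrM normfV ler_pdivrMr ?(lt_le_trans ltr01) //.
  apply: (@le_trans _ _ delta); last by rewrite ler_peMr // ltW.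
  rewrite ler_norml; move: mE2; rewrite rmorphD /= mulrDl mul1r => mE2.
  by apply/andP; split; lra.
apply: (@le_trans _ _ (P (\bigcup_j (T j `&` X i0 @^-1` win j)))).
  apply: le_measure; rewrite ?inE //; first exact: measurableI.
  by apply: bigcupT_measurable => j; exact: measurableI.
rewrite measure_bigcup //; first last.
- exact: trivIset_setIr.
- by move=> j _; exact: measurableI.
apply: (@le_trans _ _ (\sum_(0 <= j <oo | j \in [set: nat]) (q%:E * P (T j)))%E).
  apply: lee_nneseries => // j _.
  rewrite [X in (X <= _)%E](independent_of_boxes indep i0A i0J JA (mwin j) (sT j)) muleC.
  by apply: lee_wpmul2r.
rewrite nneseriesZl // -measure_bigcup //.
apply: lee_wpmul2l; first by rewrite lee_fin.
apply: le_measure; rewrite ?inE //; first exact: bigcupT_measurable.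
by move=> w [j _ []].
Qed.

End Independence.

(** * Consequences of a bounded density on [-1, 1] *)

Lemma density_window {R : realType} {d : measure_display} {Omega : measurableType d}
    (P : probability Omega R) (X : {RV P >-> R}) (f : R -> R) (phi c delta : R) :
  has_density_bounded_by P X f phi -> 0 < phi -> 0 < delta ->
  (P (X @^-1` `[(c - delta)%R, (c + delta)%R]) <= (2 * phi * delta)%:E)%E.
Proof.
move=> [mf f01 fP] phi0 d0; rewrite fP //.
set B := `[(c - delta)%R, (c + delta)%R] `&` _.
have mB : measurable B by exact: measurableI.
have BI : B `<=` `[(-1)%R, 1%R] by exact: subIsetr.
apply: (@le_trans _ _ (\int[lebesgue_measure]_(x in B) (cst phi%:E) x)%E).
  apply: ge0_le_integral => //.
  - by move=> x /BI; rewrite /= in_itv /= lee_fin => /f01/andP[].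
  - apply/measurable_EFinP; exact: (measurable_funS _ BI mf).
  - by move=> x /BI; rewrite /= in_itv /= lee_fin => /f01/andP[].
rewrite integral_cst //.
apply: (@le_trans _ _ (phi%:E * lebesgue_measure `[(c - delta)%R, (c + delta)%R])%E).
  apply: lee_wpmul2l; first by rewrite lee_fin ltW.
  by apply: le_measure; rewrite ?inE //; exact: subIsetl.
rewrite lebesgue_measure_itv /= lte_fin ifT; last by lra.
by rewrite -EFinB -EFinM lee_fin; nra.
Qed.

Lemma density_range {R : realType} {d : measure_display} {Omega : measurableType d}
    (P : probability Omega R) (X : {RV P >-> R}) (f : R -> R) (phi : R) :
  has_density_bounded_by P X f phi -> P (X @^-1` (~` `[(-1)%R, 1%R])) = 0%E.
Proof.
move=> [_ _ ->]; last exact: measurableC.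
by rewrite setIC setICr integral_set0.
Qed.

(** Mass 1 sits on an interval of length 2. This later absorbs the additive [2 ^ m] into the bound
    on the number of steps. *)
Lemma density_bound_ge {R : realType} {d : measure_display} {Omega : measurableType d}
    (P : probability Omega R) (X : {RV P >-> R}) (f : R -> R) (phi : R) :
  has_density_bounded_by P X f phi -> 0 < phi -> 1 <= 2 * phi.
Proof.
move=> fP phi0; have := density_window 0 fP phi0 ltr01.
have -> : P (X @^-1` `[(0 - 1)%R, (0 + 1)%R]) = 1%E.
  have := density_range fP; rewrite preimage_setC sub0r add0r.
  have mX : measurable (X @^-1` `[(-1)%R, 1%R]).
    by rewrite -[Y in measurable Y]setTI; exact: measurable_funP.
  rewrite probability_setC // -(fineK (fin_num_measure P _ mX)) -EFinB.
  by move=> [/eqP]; rewrite subr_eq0 => /eqP <-.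
by rewrite lee_fin mulr1.
Qed.

(** * Probability that all rows of a block are small *)

Section Rows.
Set Implicit Arguments.
Unset Strict Implicit.
Context {R : realType} {d : measure_display} {Omega : measurableType d}.
Variables (P : probability Omega R) (V : finType) (X : {set V} -> {RV P >-> R}).

Definition row_event (E : {set {set V}}) (A : V -> {set V} -> int) (delta : R)
    (S : {set V}) : set Omega :=
  [set w | forall v, v \in S -> 0 < \sum_(e in E) (A v e)%:~R * X e w <= delta].

Lemma measurable_combination (J : {set {set V}}) (a : {set V} -> int) :
  measurable_fun [set: g_sigma_algebraType (boxes X J)]
   ((fun w => \sum_(e in J) (a e)%:~R * X e w) : g_sigma_algebraType (boxes X J) -> R).
Proof.
under eq_fun do rewrite big_mkcond.
apply: measurable_sum => e; case: (boolP (e \in J)) => eJ; last exact: measurable_cst.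
by apply: measurable_funM; [exact: measurable_cst|exact: measurable_boxes].
Qed.

Lemma sigma_row_event (J : {set {set V}}) A delta S :
  <<s boxes X J >> (row_event J A delta S).
Proof.
rewrite (_ : row_event _ _ _ _ = \bigcap_(v in [set` S])
  ((fun w => \sum_(e in J) (A v e)%:~R * X e w) @^-1` `]0, delta])); last first.
  by apply/seteqP; split => w h v /h; rewrite /= in_itv.
apply: (@fin_bigcap_measurable _ (g_sigma_algebraType (boxes X J))) => // v _.
by rewrite -[X in measurable X]setTI; exact: measurable_combination.
Qed.

Lemma measurable_row_event E A delta S : measurable (row_event E A delta S).
Proof. exact: sigma_boxes_measurable (sigma_row_event _ _ _ _). Qed.

(* The row of [v] has a nonzero coefficient on some edge [e] at [v]; no row of a
   vertex outside [e] involves [e], so [X e] can be exposed last, and each round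
   uses up at most two vertices. *)
Lemma row_event_le (E : {set {set V}}) (f : {set V} -> R -> R) (phi : R)
    (A : V -> {set V} -> int) (delta : R) (S : {set V}) :
  simple_graph E -> 0 < phi -> mutually_independent P E X ->
  (forall e, e \in E -> has_density_bounded_by P (X e) (f e) phi) ->
  (forall v (e : {set V}), v \notin e -> A v e = 0) ->
  0 < delta -> 2 * phi * delta <= 1 ->
  (P (row_event E A delta S) <= ((2 * phi * delta) ^+ uphalf #|S|)%:E)%E.
Proof.
move=> Esimple phi0 indep dens A0 d0; set q := 2 * phi * delta => q1.
have q0 : 0 <= q by rewrite /q; apply/ltW; do !apply: mulr_gt0.
have [n] := ubnP #|S|; elim: n S => // n IH S; rewrite ltnS => Sn.
have [->|[v vS]] := set_0Vmem S.
  by rewrite cards0 expr0 probability_le1 //; exact: measurable_row_event.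
(* A row that vanishes on [E] violates the strict positivity in the event, which is then empty. *)
have [/existsP[e /andP[eE ae]]|/existsPn Z] :=
    boolP [exists e, (e \in E) && (A v e != 0)]; last first.
  rewrite (_ : row_event _ _ _ _ = set0) ?measure0 ?lee_fin ?exprn_ge0 //.
  apply/seteqP; split => // w /(_ v vS); rewrite big1 ?ltxx // => e eE.
  have := Z e; rewrite eE /= negbK => /eqP ->; exact: mul0r.
have ve : v \in e by apply: contraNT ae => /A0 ->.
pose S' := (S :\: e)%SET; pose J := (E :\ e)%SET.
have S'n : (#|S'| < n)%N.
  apply: leq_trans Sn; apply: proper_card; rewrite properE subsetDl /=.
  by apply/negP => /fintype.subsetP/(_ v vS); rewrite !inE ve.
have SS' : (#|S| <= #|S'|.+2)%N.
  rewrite -(cardsID e S) -addn2 addnC leq_add2l -(Esimple e eE).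
  by apply: subset_leq_card; exact: subsetIr.
have splitE u w : \sum_(e' in E) (A u e')%:~R * X e' w =
    (A u e)%:~R * X e w + \sum_(e' in J) (A u e')%:~R * X e' w.
  by rewrite (big_setD1 e).
have S'J : row_event E A delta S' = row_event J A delta S'.
  apply/seteqP; split => w h u uS'; have := h u uS'; rewrite splitE A0 ?mul0r ?add0r //;
    by move: uS'; rewrite inE => /andP[].
pose Z w := \sum_(e' in J) (A v e')%:~R * X e' w.
have mE : measurable [set w | 0 < (A v e)%:~R * X e w + Z w <= delta].
  have := measurable_row_event E A delta [set v]%SET; congr measurable.
  apply/seteqP; split => w; first by move/(_ v); rewrite splitE inE eqxx; exact.
  by move=> h u; rewrite inE => /eqP ->; rewrite splitE.
apply: (@le_trans _ _ (P (row_event J A delta S' `&`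
    [set w | (0 < (A v e)%:~R * X e w + Z w <= delta)%R]))).
  apply: le_measure; rewrite ?inE; first exact: measurable_row_event.
    apply: measurableI => //; rewrite -S'J; exact: measurable_row_event.
  move=> w h; split; last by have := h v vS; rewrite splitE.
  by rewrite -S'J => u; rewrite inE => /andP[_]; exact: h.
apply: (@le_trans _ _ (q%:E * P (row_event E A delta S'))%E).
  rewrite S'J; apply: (@anticoncentration _ _ _ P _ X E J e) => //.
  - by rewrite !inE eqxx.
  - exact: subsetDl.
  - by move=> c; exact: density_window (dens e eE) phi0 d0.
  - exact: sigma_row_event.
  - exact: measurable_combination.
apply: (@le_trans _ _ (q%:E * (q ^+ uphalf #|S'|)%:E)%E).
  by apply: lee_wpmul2l; rewrite ?lee_fin //; exact: IH.
(* Losing at most two vertices lowers [uphalf] by at most one, and powers of [q <= 1] do not grow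
   with the exponent. *)
rewrite -EFinM lee_fin -exprS ler_wiXn2l //.
by have := uphalf_leq SS'.
Qed.

End Rows.

(** * Termination and the union bound *)

Section Termination.
Set Implicit Arguments.
Unset Strict Implicit.
Context {R : realType} {V : finType} {k : nat}.
Variables (E : {set {set V}}).
Hypothesis Esimple : simple_graph E.
Implicit Types (wt : {set V} -> R) (c : kcut V k).

Lemma simple_graph_card : (2 * #|E| <= #|V| ^ 2)%N.
Proof.
have : (#|E| <= 'C(#|V|, 2))%N.
  rewrite -card_draws; apply: subset_leq_card; apply/fintype.subsetP => e eE.
  by rewrite inE; apply/eqP; exact: Esimple.
rewrite bin2; have : (2 * (#|V| * #|V|.-1)./2 <= #|V| * #|V|.-1)%N by lia.
have : (#|V| * #|V|.-1 <= #|V| ^ 2)%N by rewrite leq_mul2l leq_pred orbT.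
lia.
Qed.

Lemma cut_value_le wt c : (forall e, e \in E -> `|wt e| <= 1) ->
  `|cut_value E wt c| <= #|E|%:R.
Proof.
move=> w1; rewrite /cut_value big_mkcondr /=; apply: le_trans (ler_norm_sum _ _ _) _.
rewrite -sumr_const; apply: ler_sum => e eE.
by case: ifP => _; rewrite ?normr0 // w1.
Qed.

Lemma run_add c mv pt s t : run c mv pt (s + t) =
  run (run c mv pt s) (fun u => mv (s + u)%N) (fun u => pt (s + u)%N) t.
Proof. by elim: t => [|t IH]; rewrite ?addn0 // addnS /= IH. Qed.

Lemma busy_shift (mv : nat -> V) s l : busy k mv s l = busy k (fun t => mv (s + t)%N) 0 l.
Proof.
apply/setP => v; rewrite !inE /visits; congr (_ <= _)%N.
have := @big_addn _ 0%N addn 0 (s + l) s xpredT (fun t => nat_of_bool (mv t == v)).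
rewrite !add0n addKn => ->; by apply: eq_bigr => t _; rewrite addnC.
Qed.

Lemma cut_after_run wt (I : implementation V k) t :
  (forall u, (u < t)%N -> ~~ locally_optimal E wt (cut_after E wt I u)) ->
  cut_after E wt I t = run (initial_cut I) (chosen_vertex I) (chosen_part I) t.
Proof.
elim: t => // t IH no /=; rewrite (negPf (no t _)) // IH // => u ut.
by apply: no; rewrite ltnS ltnW.
Qed.

Lemma flip_terminates wt m (eps T : R) :
  (2 <= k)%N -> (2 * k.-1 * #|V| < 2 ^ m)%N ->
  (forall e, e \in E -> `|wt e| <= 1) -> 0 < eps ->
  (forall c mv pt i, (i <= m)%N ->
    (2 ^ i < #|busy k mv 0 (2 ^ i)| * (2 * k.-1 * m))%N ->
    ~ (forall t, (t < 2 ^ i)%N -> 0 < cut_value E wt (run c mv pt t.+1) -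
                                 cut_value E wt (run c mv pt t) <= eps)) ->
  (2 ^ m)%:R * (#|V|%:R ^+ 2 / eps + 1) <= T ->
  every_flip_terminates_within k E wt T.
Proof.
move=> k2 Vm w1 e0 H TT I flip; apply: contrapT => NT.
have V2 : 0 <= #|V|%:R ^+ 2 / eps by rewrite divr_ge0 ?exprn_ge0 // ltW.
(* [J] windows of [2 ^ m] moves, each gaining [eps], would gain more than [#|V| ^ 2], while cut
   values differ by at most [2 * #|E| <= #|V| ^ 2]. *)
pose J := (Num.trunc (#|V|%:R ^+ 2 / eps)).+1.
pose Tn := (J * 2 ^ m)%N.
have TnT : Tn%:R <= T.
  apply: le_trans TT; rewrite natrM mulrC ler_wpM2l // /J -natr1 lerD2r.
  by rewrite Num.Theory.truncn_le.
have no t : (t <= Tn)%N -> ~~ locally_optimal E wt (cut_after E wt I t).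
  move=> tT; apply/negP => lo; apply: NT; exists t; split => //.
  by apply: le_trans TnT; rewrite ler_nat.
have cr t : (t <= Tn)%N -> cut_after E wt I t =
    run (initial_cut I) (chosen_vertex I) (chosen_part I) t.
  by move=> tT; apply: cut_after_run => u ut; apply: no; exact: ltnW (leq_trans ut tT).
pose c0 := initial_cut I; pose mv := chosen_vertex I; pose pt := chosen_part I.
pose val t := cut_value E wt (run c0 mv pt t).
have incr t : (t < Tn)%N -> val t < val t.+1.
  move=> tT; have /andP[_] := flip t (no t (ltnW tT)).
  by rewrite cr ?(ltnW tT).
have mono a b : (a <= b)%N -> (b <= Tn)%N -> val a <= val b.
  elim: b => [|b IH]; first by rewrite leqn0 => /eqP ->.
  rewrite leq_eqVlt => /orP[/eqP->//|ab bT].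
  by apply: le_trans (IH ab (ltnW bT)) _; exact: ltW (incr _ bT).
(* The window contains a busy block, where [H] forbids that all gains lie in [(0, eps]]; as all are
   positive, one exceeds [eps]. *)
have jump s : (s + 2 ^ m <= Tn)%N -> val s + eps <= val (s + 2 ^ m)%N.
  move=> sT.
  have [s' [i [im sm]]] := exists_busy_block (fun t => mv (s + t)%N) k2 Vm.
  rewrite busy_shift => big.
  have := H (run c0 mv pt (s + s')%N) _ (fun t => pt (s + s' + t)%N) i im big.
  move=> /existsNP[t /not_implyP[tl /negP]].
  have rE u : run (run c0 mv pt (s + s')%N) (fun t => mv (s + (s' + t))%N)
      (fun t => pt (s + s' + t)%N) u = run c0 mv pt (s + s' + u)%N.
    rewrite [RHS]run_add (_ : (fun t => _) = (fun t => mv (s + s' + t)%N)) //.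
    by apply/funext => x; rewrite addnA.
  rewrite !rE -/(val _) addnS -/(val _) subr_gt0 incr ?andTb; last first.
    by apply: leq_trans sT; rewrite -addnA -addnS leq_add2l; lia.
  rewrite -ltNge ltrBrDr => gap.
  apply: le_trans (_ : val (s + s' + t).+1 <= _); last by apply: mono => //; lia.
  apply: le_trans (ltW gap); rewrite addrC lerD2l; apply: mono; lia.
have climb j : (j <= J)%N -> val 0 + j%:R * eps <= val (j * 2 ^ m)%N.
  elim: j => [|j IH] jJ; first by rewrite mul0r addr0 mul0n.
  rewrite -natr1 mulrDl mul1r addrA mulSn addnC.
  apply: (@le_trans _ _ (val (j * 2 ^ m)%N + eps)); first by rewrite lerD2r IH // ltnW.
  by apply: jump; rewrite addnC -mulSn leq_mul2r jJ orbT.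
have := climb J (leqnn _).
have : #|V|%:R ^+ 2 < J%:R * eps.
  by rewrite -ltr_pdivrMr //; exact: Num.Theory.truncnS_gt.
have : 2 * #|E|%:R <= #|V|%:R ^+ 2 :> R.
  by rewrite -natrX -natrM ler_nat simple_graph_card.
have := cut_value_le (run c0 mv pt 0) w1; have := cut_value_le (run c0 mv pt (J * 2 ^ m)%N) w1.
rewrite -/(val _) -/(val _) !ler_norml => /andP[h1 h2] /andP[h3 h4].
lra.
Qed.

(** FLIP consults the weights only through comparisons of cut values. *)
Lemma every_flip_order wt wt' T :
  (forall c c', (cut_value E wt c < cut_value E wt c') =
                (cut_value E wt' c < cut_value E wt' c')) ->
  every_flip_terminates_within k E wt T -> every_flip_terminates_within k E wt' T.
Proof.
move=> cmp.
have loE c : locally_optimal E wt c = locally_optimal E wt' c.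
  congr (~~ _); apply: eq_existsb => v; apply: eq_existsb => p.
  by rewrite /improving cmp.
have caE (I : implementation V k) t : cut_after E wt I t = cut_after E wt' I t.
  by elim: t => //= t ->; rewrite loE.
move=> H I flip; have [t no|t [tT lo]] := H I.
  by have := flip t; rewrite -caE -loE /improving cmp => /(_ no).
by exists t; split => //; rewrite -caE -loE.
Qed.

End Termination.

(** * Union bound and measurability of the good event *)

Section UnionBound.
Set Implicit Arguments.
Unset Strict Implicit.
Context {R : realType} {d : measure_display} {Omega : measurableType d}.
Variable P : probability Omega R.

Lemma measurable_finU (I : finType) (Q : pred I) (F : I -> set Omega) :
  (forall i, Q i -> measurable (F i)) -> measurable [set w | exists2 i, Q i & F i w].
Proof.
move=> mF; rewrite (_ : [set w | _] = \bigcup_(i in [set` Q]) F i) //.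
by apply: fin_bigcup_measurable.
Qed.

Lemma union_bound (I : finType) (Q : pred I) (F : I -> set Omega) (c : R) :
  (forall i, Q i -> measurable (F i)) -> 0 <= c ->
  (forall i, Q i -> (P (F i) <= c%:E)%E) ->
  (P [set w | exists2 i, Q i & F i w] <= (#|I|%:R * c)%:E)%E.
Proof.
move=> mF c0 Pc.
have -> : [set w | exists2 i, Q i & F i w] = \big[setU/set0]_(i <- enum I | Q i) F i.
  rewrite -bigcup_seq_cond; apply/seteqP; split => w [i Qi Fi]; exists i => //=.
    by rewrite mem_enum Qi.
  by move: Qi => /= /andP[].
rewrite cardE; elim: (enum I) => [|i s IH]; first by rewrite big_nil measure0 mul0r.
have mS : measurable (\big[setU/set0]_(j <- s | Q j) F j) by exact: bigsetU_measurable.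
rewrite big_cons /= -natr1 mulrDl mul1r EFinD.
case: ifP => Qi; last by apply: le_trans IH _; rewrite leeDl // lee_fin.
apply: le_trans (measureU2 _ (mF _ Qi) mS) _.
by rewrite addeC; apply: leeD => //; exact: Pc.
Qed.

(** The quantifier over implementations is uncountable, but by [every_flip_order] the event depends
    only on the finite table of comparisons between cuts. It is thus a finite union of events fixing
    that table. *)
Lemma measurable_every_flip (V : finType) (k : nat) (E : {set {set V}})
    (X : {set V} -> {RV P >-> R}) (T : R) :
  measurable [set w | every_flip_terminates_within k E (fun e => X e w) T].
Proof.
pose val w c := cut_value E (fun e => X e w) (c : kcut V k).
pose cmp w : {ffun kcut V k * kcut V k -> bool} := [ffun p => val w p.1 < val w p.2].
pose Q g := `[< exists2 w : Omega, cmp w = g &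
  every_flip_terminates_within k E (fun e => X e w) T >].
have -> : [set w | every_flip_terminates_within k E (fun e => X e w) T] =
    [set w | exists2 g, Q g & cmp w = g].
  apply/seteqP; split => [w gw|w [g /asboolP[w' w'g good] wg]].
    by exists (cmp w) => //; apply/asboolP; exists w.
  apply: every_flip_order good => c c'; move: w'g; rewrite -wg => /ffunP/(_ (c, c')).
  by rewrite !ffunE.
apply: measurable_finU => g _.
rewrite [Y in measurable Y](_ : _ =
    \bigcap_(p in [set` finset.setT]) [set w | (val w p.1 < val w p.2) = g p]); last first.
  apply/seteqP; split => [w <- p _|w h]; first by rewrite /= ffunE.
  by apply/ffunP => p; rewrite ffunE; apply: h; rewrite /= inE.
apply: fin_bigcap_measurable => // p _.
have mval c : measurable_fun setT (val^~ c).
  rewrite /val /cut_value; under eq_fun do rewrite big_mkcond.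
  apply: measurable_sum => e; case: (_ && _) => //; exact: measurable_funP.
have mlt : measurable [set w | val w p.1 < val w p.2].
  rewrite (_ : [set w | _] = (fun w => val w p.2 - val w p.1) @^-1` `]0, +oo[); last first.
    by apply/seteqP; split => w; rewrite /= in_itv /= andbT subr_gt0.
  by rewrite -[Y in measurable Y]setTI; apply: measurable_funB.
case: (g p) => //.
rewrite (_ : [set w | _] = ~` [set w | val w p.1 < val w p.2]); first exact: measurableC.
by apply/seteqP; split => w /=; case: ltP.
Qed.

End UnionBound.

(** * Small gains throughout a busy block are unlikely *)

Section Smoothed.
Set Implicit Arguments.
Unset Strict Implicit.
Context {R : realType} {d : measure_display} {Omega : measurableType d}.
Variables (P : probability Omega R) (V : finType) (E : {set {set V}}) (k m : nat).
Variables (X : {set V} -> {RV P >-> R}) (f : {set V} -> R -> R) (phi : R).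
Hypotheses (k2 : (2 <= k)%N) (Vm : (2 * k.-1 * #|V| < 2 ^ m)%N) (V0 : (0 < #|V|)%N).
Hypotheses (Esimple : simple_graph E) (phi0 : 0 < phi).
Hypothesis indep : mutually_independent P E X.
Hypothesis dens : forall e, e \in E -> has_density_bounded_by P (X e) (f e) phi.

(** Each of the [m + 1] block lengths may fail with probability [q], in all [1 / #|V|]. The choice
    of [eps] gives [2 * phi * 2 ^ m * eps = 1 / M], where [1 / M] is [q] divided by the power of
    [#|V| * k * k], the number of codes per move, that pays for the union bound. *)
Let M := (#|V| * m.+1 * (#|V| * k * k) ^ (4 * k.-1 * m))%N.
Let eps : R := (2 * phi * (2 ^ m * M)%:R)^-1.
Let q : R := (#|V| * m.+1)%:R^-1.

Let K0 : (0 < #|V| * k * k)%N. Proof. by rewrite !muln_gt0 V0; lia. Qed.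
Let M0 : (0 < M)%N. Proof. by rewrite !muln_gt0 V0 expn_gt0 K0. Qed.
Let eps0 : 0 < eps.
Proof. by rewrite invr_gt0 !mulr_gt0 // ltr0n muln_gt0 expn_gt0 M0. Qed.
Let q0 : 0 < q. Proof. by rewrite invr_gt0 ltr0n muln_gt0 V0. Qed.
Let q1 : q <= 1. Proof. by rewrite invf_le1 ?ler1n ?ltr0n muln_gt0 V0. Qed.

(* The rank of a block exceeds its length divided by [4 (k - 1) m], so [eps] is
   small enough to beat the number of codes of the block. *)
Lemma bad_block i : (i <= m)%N -> exists B : set Omega, [/\ measurable B,
  (P B <= q%:E)%E &
  forall w (c : kcut V k) mv pt,
    (2 ^ i < #|busy k mv 0 (2 ^ i)| * (2 * k.-1 * m))%N ->
    (forall t, (t < 2 ^ i)%N ->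
       0 < cut_value E (fun e => X e w) (run c mv pt t.+1) -
           cut_value E (fun e => X e w) (run c mv pt t) <= eps) -> B w].
Proof.
move=> im; have [S [A [A0 HA]]] := @block_rows V k R E (2 ^ i) Esimple.
pose Q x := (2 ^ i < #|S x| * (2 * k.-1 * m))%N.
pose F x := row_event X E (A x) ((2 ^ i)%:R * eps) (S x).
have mF x : measurable (F x) by exact: measurable_row_event.
exists [set w | exists2 x, Q x & F x w]; split.
- by apply: measurable_finU.
- pose K : R := (#|V| * k * k)%:R.
  have KR0 : 0 < K by rewrite ltr0n.
  have K1 : 1 <= K by rewrite ler1n.
  have := @union_bound _ _ _ P _ Q F ((K ^+ (2 ^ i))^-1 * q).
  rewrite card_tuple !card_prod card_ord natrX mulrA mulfV ?mul1r; last first.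
    by rewrite expf_neq0 // gt_eqF.
  apply => // [|x Qx]; first by rewrite mulr_ge0 ?invr_ge0 ?exprn_ge0 // ltW.
  have MR0 : 0 < M%:R :> R by rewrite ltr0n.
  have NR0 : 0 < (2 ^ m)%:R :> R by rewrite ltr0n expn_gt0.
  have dM : 2 * phi * ((2 ^ i)%:R * eps) <= M%:R^-1.
    rewrite /eps natrM; have -> : 2 * phi * ((2 ^ i)%:R * (2 * phi * ((2 ^ m)%:R * M%:R))^-1) =
        ((2 ^ i)%:R / (2 ^ m)%:R) * M%:R^-1 :> R.
      by field; rewrite !gt_eqF.
    rewrite ler_piMl ?invr_ge0 // ler_pdivrMr // mul1r ler_nat.
    by rewrite leq_exp2l.
  have d0 : 0 < (2 ^ i)%:R * eps by rewrite mulr_gt0 // ltr0n expn_gt0.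
  have M1 : M%:R^-1 <= 1 :> R by rewrite invf_le1 ?ler1n.
  have := row_event_le (S x) Esimple phi0 indep dens (A0 x) d0 (le_trans dM M1).
  move=> /le_trans; apply; rewrite lee_fin.
  set r := uphalf _.
  have Sr : (#|S x| <= 2 * r)%N by rewrite /r; lia.
  have lr : (2 ^ i <= 4 * k.-1 * m * r)%N.
    have : (#|S x| * (2 * k.-1 * m) <= 2 * r * (2 * k.-1 * m))%N by rewrite leq_mul2r Sr orbT.
    move: Qx; rewrite /Q; nia.
  have r0 : (0 < r)%N by move: lr; case: r {Sr} => //; rewrite muln0 leqn0 expn_eq0.
  apply: (@le_trans _ _ (M%:R^-1 ^+ r)).
    by rewrite lerXn2r // nnegrE ?invr_ge0 // !mulr_ge0 // ltW.
  (* The first factor cancels the [K ^ (2 ^ i)] codes because [2 ^ i <= 4 * k.-1 * m * r]; since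
     [r >= 1], the second is at most [q]. *)
  have -> : M%:R^-1 ^+ r = (K ^+ (4 * k.-1 * m * r))^-1 * q ^+ r.
    by rewrite /M natrM natrX invfM exprMn mulrC exprVn -exprM.
  apply: ler_pM; rewrite ?invr_ge0 ?exprn_ge0 ?(ltW q0) ?(ltW KR0) //.
    by rewrite lef_pV2 ?posrE ?exprn_gt0 // ler_weXn2l.
  by rewrite -{2}[q]expr1 ler_wiXn2l // ltW.
move=> w c mv pt; have [x Sx Hx] := HA c mv pt; rewrite -Sx => big small.
exists x => // v vS; rewrite /=.
exact: Hx.
Qed.

(** Off the bad blocks and the null event of a weight outside [-1, 1], [flip_terminates] applies.
    The bad blocks range over all starting cuts and move sequences, so every implementation is
    covered at once. *)
Lemma flip_good_probability (T : R) :
  (2 ^ m)%:R * (#|V|%:R ^+ 2 / eps + 1) <= T ->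
  ((1 - #|V|%:R^-1)%:E <=
   P [set w | every_flip_terminates_within k E (fun e => X e w) T])%E.
Proof.
move=> TT.
have /choice[B HB] (i : nat) : exists B : set Omega, (i <= m)%N -> [/\ measurable B,
  (P B <= q%:E)%E &
  forall w (c : kcut V k) mv pt,
    (2 ^ i < #|busy k mv 0 (2 ^ i)| * (2 * k.-1 * m))%N ->
    (forall t, (t < 2 ^ i)%N ->
       0 < cut_value E (fun e => X e w) (run c mv pt t.+1) -
           cut_value E (fun e => X e w) (run c mv pt t) <= eps) -> B w].
  have [/bad_block[B HB]|_] := boolP (i <= m)%N; first by exists B.
  by exists set0.
pose bad1 := [set w | exists2 i : 'I_m.+1, predT i & B i w].
pose bad2 := [set w | exists2 e : {set V}, e \in E & (X e @^-1` (~` `[-1, 1])) w].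
have mB (i : 'I_m.+1) : predT i -> measurable (B i).
  by move=> _; have [] := HB i (ltn_ord i).
have mX e : e \in E -> measurable (X e @^-1` (~` `[-1, 1])).
  move=> _; rewrite -[Y in measurable Y]setTI; apply: measurable_funP => //.
  exact: measurableC.
have m1 : measurable bad1 by exact: measurable_finU.
have m2 : measurable bad2 by exact: measurable_finU.
have P1 : (P bad1 <= #|V|%:R^-1%:E)%E.
  have := @union_bound _ _ _ P _ predT (fun i : 'I_m.+1 => B i) q mB (ltW q0).
  have -> : #|'I_m.+1|%:R * q = #|V|%:R^-1.
    by rewrite card_ord /q natrM invfM mulrCA mulfV ?mulr1 ?pnatr_eq0.
  apply.
  by move=> i _; have [] := HB i (ltn_ord i).
have P2 : (P bad2 <= 0)%E.
  have := @union_bound _ _ _ P _ (mem E) (fun e => X e @^-1` (~` `[-1, 1])) 0 mX.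
  rewrite mulr0; apply => // e eE; by rewrite (density_range (dens eE)).
have mbad := measurableU _ _ m1 m2.
have Pbad : (P (bad1 `|` bad2) <= #|V|%:R^-1%:E)%E.
  apply: le_trans (measureU2 P m1 m2) _.
  by rewrite -[leRHS]adde0 leeD.
apply: (@le_trans _ _ (P (~` (bad1 `|` bad2)))).
  rewrite probability_setC // -(fineK (fin_num_measure P _ mbad)) -EFinB lee_fin lerD2l lerN2.
  by rewrite -lee_fin fineK // fin_num_measure.
apply: le_measure; rewrite ?inE; [exact: measurableC|exact: measurable_every_flip|].
move=> w /= nbad.
apply: (flip_terminates Esimple k2 Vm _ eps0 _ TT) => [e eE|c mv pt i im big small].
  rewrite ler_norml; apply: contrapT => /negP out; apply: nbad; right; exists e => //=.
  by rewrite in_itv /=; exact/negP.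
apply: nbad; left; exists (Ordinal (im : (i < m.+1)%N)) => //=.
by have [_ _] := HB i im; apply; [exact: big|exact: small].
Qed.

End Smoothed.

(** * Asymptotics *)

Lemma half_le_ln2 (R : realType) : 2^-1 <= ln (2 : R).
Proof.
have : ln (1 + - 2^-1 : R) <= - 2^-1 by apply: le_ln1Dx; lra.
have -> : (1 + - 2^-1 : R) = 2^-1 by lra.
by rewrite lnV ?posrE // lerN2.
Qed.

Lemma ln2_le1 (R : realType) : ln (2 : R) <= 1.
Proof. by have := @le_ln1Dx R 1; apply; lra. Qed.

(* With [L = ln n], the logarithm of the left-hand side is [8 (k - 1) L^2 + O(L)],
   against [2 (2k - 1) k L^2 + O(L)] on the right, and
   [2 (2k - 1) k - 8 (k - 1) - 4 = 2 (2k - 1) (k - 2)]. *)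
Lemma flip_bound_asymptotics (R : realType) (k : nat) (eta : R) :
  (2 <= k)%N -> 0 < eta ->
  exists2 n0 : nat, (0 < n0)%N & forall n m : nat, (n0 <= n)%N ->
    (2 ^ m <= 4 * k * n)%N ->
    ((4 * (2 ^ m) ^ 3 * n ^ 3 * (n * k * k) ^ (4 * k.-1 * m))%N)%:R <=
    n%:R `^ (2 * (2 * k%:R - 1) * k%:R * ln (k%:R * n%:R) + 3 + eta).
Proof.
move=> k2 eta0.
pose lam : R := ln k%:R; pose kap : R := k%:R - 1.
have kR : 2 <= k%:R :> R by rewrite ler_nat.
have lam0 : 0 <= lam by apply: ln_ge0; lra.
have kap1 : 1 <= kap by rewrite /kap; lra.
(* [B] is the coefficient of [L] left over once constants are bounded by multiples of [L >= 1] and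
   the [3 * L] of the right-hand side is subtracted. For [L >= B] this remainder is at most
   [L ^ 2]. *)
pose B := 11 + 3 * lam + 8 * kap * (2 + 3 * lam + 2 * lam * (2 + lam)).
have B1 : 1 <= B.
  have : 0 <= kap * (2 + 3 * lam + 2 * lam * (2 + lam)).
    by apply: mulr_ge0; [lra|nra].
  by rewrite /B; lra.
exists (Num.trunc (expR B)).+1 => // n m n0n mle.
have n0 : (0 < n)%N by exact: leq_ltn_trans n0n.
have nR : 0 < n%:R :> R by rewrite ltr0n.
pose L : R := ln n%:R.
have LB : B <= L.
  rewrite -[B]expRK ler_ln ?posrE ?expR_gt0 //.
  apply/ltW/(@lt_le_trans _ _ (Num.trunc (expR B)).+1%:R); last by rewrite ler_nat.
  exact: Num.Theory.truncnS_gt.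
have k0 : (0 < k)%N by lia.
have kR0 : 0 < k%:R :> R by rewrite ltr0n.
have mN : m%:R * ln 2 <= 2 + lam + L :> R.
  have : ln ((2 ^ m)%:R : R) <= ln ((4 * k * n)%:R : R).
    by rewrite ler_ln ?posrE ?ltr0n ?expn_gt0 ?ler_nat // !muln_gt0 k0 n0.
  rewrite natrX lnXn // -[ln 2 *+ m]mulr_natl => /le_trans; apply.
  rewrite !natrM !lnM ?posrE ?mulr_gt0 // -/lam -/L !lerD2r.
  have -> : (4 : R) = 2 ^+ 2 by rewrite -natrX.
  by rewrite lnXn // mulr2n; have := ln2_le1 R; lra.
have m2 : m%:R <= 2 * (2 + lam + L).
  have := half_le_ln2 R; have : 0 <= m%:R :> R by []; nra.
set lhs := (X in X%:R).
have lhs0 : 0 < lhs%:R :> R.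
  by rewrite ltr0n /lhs !muln_gt0 !expn_gt0 !muln_gt0 n0 k0.
rewrite -(@lnK _ lhs%:R) ?posrE // /powR gt_eqF // ler_expR.
rewrite lnM ?posrE // -/lam -/L.
have -> : ln (lhs%:R : R) = ln 4 + 3 * (m%:R * ln 2) + 3 * L +
    4 * kap * m%:R * (L + 2 * lam).
  rewrite /lhs !(natrM, natrX) !lnM ?posrE ?mulr_gt0 ?exprn_gt0 //; last first.
    by rewrite !mulr_gt0.
  have lnX (x : R) p : 0 < x -> ln (x ^+ p) = p%:R * ln x.
    by move=> x0; rewrite lnXn // mulr_natl.
  rewrite !lnX ?exprn_gt0 ?mulr_gt0 // !lnM ?posrE ?mulr_gt0 // -/lam -/L.
  rewrite !natrM -subn1 natrB // -/kap; ring.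
have ln4 : ln (4 : R) <= 2.
  have -> : (4 : R) = 2 ^+ 2 by rewrite -natrX.
  by rewrite lnXn // mulr2n; have := ln2_le1 R; lra.
have L1 : 1 <= L by exact: le_trans LB.
have kE : 2 * (2 * k%:R - 1) * k%:R >= 8 * kap + 4.
  rewrite /kap; nra.
have e1 : 4 * kap * m%:R * (L + 2 * lam) <=
    4 * kap * (2 * (2 + lam + L)) * (L + 2 * lam).
  apply: ler_wpM2r; first lra.
  by apply: ler_wpM2l => //; lra.
have e2 : (8 * kap + 4) * L ^+ 2 <= (2 * (2 * k%:R - 1) * k%:R) * L ^+ 2.
  by apply: ler_wpM2r => //; rewrite exprn_ge0 //; lra.
have e3 : 0 <= (2 * (2 * k%:R - 1) * k%:R) * lam * L.
  by rewrite !mulr_ge0 //; lra.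
have e4 : B * L <= L ^+ 2 by rewrite expr2 ler_wpM2r //; lra.
have e5 : 0 <= eta * L by rewrite mulr_ge0 //; lra.
have e6 : (8 + 3 * lam + 8 * kap * (2 * lam * (2 + lam))) * 1 <=
    (8 + 3 * lam + 8 * kap * (2 * lam * (2 + lam))) * L.
  apply: ler_wpM2l => //.
  by rewrite !addr_ge0 ?mulr_ge0 //; lra.
have e7 : 0 <= L ^+ 2 by rewrite exprn_ge0 //; lra.
rewrite /B in e4; lra.
Qed.

(** * Choice of the block length and of the failure probability *)

Theorem theorem1p3 (R : realType) (k : nat) (hk : (2 <= k)%N)
    (eta : R) (heta : 0 < eta) :
  exists C : R, 0 < C /\
  exists delta : nat -> R, (delta n @[n --> \oo] --> (0 : R)) /\
  forall (n : nat) (V : finType) (E : {set {set V}}) (phi : R)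
    (d : measure_display) (Omega : measurableType d)
    (P : probability Omega R)
    (X : {set V} -> {RV P >-> R}) (f : {set V} -> R -> R),
    #|V| = n ->
    simple_graph E ->
    0 < phi ->
    mutually_independent P E X ->
    (forall e, e \in E -> has_density_bounded_by P (X e) (f e) phi) ->
    let bound : R :=
      C * (phi * n%:R `^ (2 * (2 * k%:R - 1) * k%:R * ln (k%:R * n%:R)
                          + 3 + eta)) in
    let good : set Omega :=
      [set w | every_flip_terminates_within k E (fun e => X e w) bound] in
    measurable good /\ ((1 - delta n)%:E <= P good)%E.
Proof.
have [n0 n0_gt0 asym] := @flip_bound_asymptotics R k eta hk heta.
exists 1; split => //.
(* Below the threshold [n0] the failure probability 1 makes the claim trivial. *)
exists (fun n => if (n < n0)%N then 1 else n%:R^-1); split.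
  rewrite -cvg_shiftS; apply: cvg_trans (@cvg_harmonic R).
  apply: near_eq_cvg; near=> n.
  rewrite /harmonic /= ltnNge (_ : (n0 <= n.+1)%N) //.
  by apply: leqW; near: n; exact: nbhs_infty_ge.
move=> n V E phi d Omega P X f Vn Esimple phi0 indep dens bound good.
split; first exact: measurable_every_flip.
case: ltnP => nn0; first by rewrite subrr.
have V0 : (0 < #|V|)%N by rewrite Vn; exact: leq_trans nn0.
(* Without edges no density bounds [phi] from below, but all cuts have value 0 and FLIP stops at
   once. *)
have [E0|[e eE]] := set_0Vmem E.
  rewrite (_ : good = setT) ?probability_setT ?lee_fin ?gerBl ?invr_ge0 //.
  apply/seteqP; split => // w _ I _; exists 0; split.
    by rewrite !mulr_ge0 ?powR_ge0 // ltW.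
  apply/existsPn => v; apply/existsPn => p.
  by rewrite /improving /cut_value E0 !big1 ?ltxx ?andbF // => e; rewrite inE.
have phi1 := density_bound_ge (dens e eE) phi0.
(* The least window length [2 ^ m] above [2 * (k - 1) * n]; it is at most twice that number. *)
pose m := (trunc_log 2 (2 * k.-1 * n)).+1.
have Vm : (2 * k.-1 * #|V| < 2 ^ m)%N by rewrite Vn; exact: trunc_log_ltn.
have mle : (2 ^ m <= 4 * k * n)%N.
  rewrite expnS; have : (2 ^ trunc_log 2 (2 * k.-1 * n) <= 2 * k.-1 * n)%N.
    by apply: trunc_logP => //; rewrite !muln_gt0 -Vn V0; lia.
  move: (2 ^ _)%N => N; nia.
rewrite -Vn; apply: (flip_good_probability hk Vm V0 Esimple phi0 indep dens).
rewrite /bound mul1r invrK -Vn.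
set M := (_ * m.+1 * _)%N.
have M0 : (0 < M)%N by rewrite !muln_gt0 V0 expn_gt0 !muln_gt0 V0; lia.
have := asym n m nn0 mle; rewrite -Vn => asymV.
apply: le_trans (ler_wpM2l (ltW phi0) asymV).
(* Bounding the factor [m + 1] of [M] by [2 ^ m] turns the square of [2 ^ m] into the cube of
   [asym]. *)
apply: (@le_trans _ _ (phi * (4 * (2 ^ m) ^ 2 * #|V| ^ 2 * M)%:R)); last first.
  rewrite ler_wpM2l ?(ltW phi0) // ler_nat /M.
  have m1 : (m.+1 <= 2 ^ m)%N by rewrite ltn_expl.
  move: (_ ^ (4 * k.-1 * m))%N (2 ^ m)%N m1 => a N mN; move: #|V| => v.
  rewrite (_ : 4 * N ^ 3 * v ^ 3 * a = (4 * N ^ 2 * v ^ 3 * a) * N)%N; last by rewrite !expnS; lia.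
  rewrite (_ : 4 * N ^ 2 * v ^ 2 * (v * m.+1 * a) = (4 * N ^ 2 * v ^ 3 * a) * m.+1)%N;
    last by rewrite !expnS; lia.
  by rewrite leq_mul2l mN orbT.
move: (M) M0 => {}M M0.
have one : 1 <= ((2 ^ m)%:R * #|V|%:R ^+ 2 * M%:R : R).
  by rewrite -natrX -!natrM ler1n !muln_gt0 !expn_gt0 V0 M0.
rewrite !natrM !natrX; rewrite natrX in one.
move: one; set N := 2 ^+ m; set v := _ ^+ 2; set a := M%:R => one.
have N0 : 0 <= N by rewrite exprn_ge0.
(* As [2 * phi >= 1], the additive [N] is at most the main term, which doubles the constant 2 to
   4. *)
have : N * 1 <= N * (2 * phi * (N * v * a)).
  by rewrite ler_wpM2l // mulr_ege1.
have -> : N * (v * (2 * phi * (N * a)) + 1) = N * (2 * phi * (N * v * a)) + N * 1 by ring.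
have -> : phi * (4 * N ^+ 2 * v * a) = N * (2 * phi * (N * v * a)) + N * (2 * phi * (N * v * a)).
  by ring.
lra.
Unshelve. all: by end_near.
Qed.
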